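(* Let $(D,\triangleright)$ be a rack with $|D|>1$, let $r_\triangleright:D\times D\to D\times D$, $r_\triangleright(a,b)=(b,b\triangleright a)$, be its associated left derived solution, and set $$M_D:=\inf\{n\in\mathbb{N}\mid\forall\,a,b\in D\quad (L_bL_a)^nL_b^{-n}(b)=a\},$$ $$N_D:=\inf\{n\in\mathbb{N}\mid\forall\,a,b\in D\quad (L_bL_a)^nL_b^{-n}(b)=b\}.$$ Denote by $o(r_\triangleright)$ the order of $r_\triangleright$ as an element of $\mathrm{Sym}(D\times D)$. Then: 1) If $D$ is not a quandle, then $r_\triangleright$ has finite order if and only if $N_D$ is finite; in particular, $o(r_\triangleright)=2N_D$. 2) If $D$ is a quandle, then $r_\triangleright$ has finite order if and only if $\min\{M_D,N_D\}$ is finite. In particular, the following cases occur: (a) if $M_D<N_D$ then $o(r_\triangleright)=2M_D+1$; (b) if $N_D<M_D$ then $o(r_\triangleright)=2N_D$.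
   Context: A (left) shelf $(D,\triangleright)$ is a non-empty set with a binary operation satisfying $a\triangleright(b\triangleright c)=(a\triangleright b)\triangleright(a\triangleright c)$. For $a\in D$, $L_a:D\to D$ is $L_a(b)=a\triangleright b$. A rack is a shelf in which all $L_a$ are bijective; a quandle is a rack with $a\triangleright a=a$ for all $a$. $\mathbb{N}$ denotes the positive integers and $\inf\emptyset=\infty$. *)

(* Defs.v *)
From HB Require Import structures.
From mathcomp Require Import all_boot all_order all_algebra.
From mathcomp Require Import boolp classical_sets constructive_ereal.

Set Implicit Arguments.
Unset Strict Implicit.
Unset Printing Implicit Defensive.

Import Order.TTheory GRing.Theory Num.Theory.

Local Open Scope classical_set_scope.

Definition infpos (P : nat -> Prop) : \bar int :=
  infimum +oo%E [set n%:Z%:E | n in [set n : nat | (0 < n)%N /\ P n]].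

Lemma infpos_min (P : nat -> Prop) (n : nat) :
  (0 < n)%N -> P n -> (forall m, (0 < m)%N -> P m -> (n <= m)%N) ->
  infpos P = n%:Z%:E.
Proof.
move=> n0 Pn nmin; rewrite /infpos /infimum; set A := (X in infimums X).
have An : A n%:Z%:E by exists n.
have Sn : infimums A n%:Z%:E.
  split; last by move=> y; apply.
  by move=> _ [m [m0 Pm] <-]; rewrite lee_fin lez_nat nmin.
case: ifPn => [/eqP A0|_]; first by move: An; rewrite /A A0.
by case: xgetP => [y _ Sy|/(_ _ Sn) //]; exact: is_subset1_infimums Sy Sn.
Qed.

Lemma infpos_oo (P : nat -> Prop) :
  (forall m, (0 < m)%N -> ~ P m) -> infpos P = +oo%E.
Proof.
move=> nP; rewrite /infpos /infimum ifT //; apply/eqP/seteqP.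
by split=> // x [n [n0 /(nP _ n0)]].
Qed.

(* The symmetric group of an arbitrary, possibly infinite, type.  The product
   is composition: (f * g) x = f (g x), unlike the one of mathcomp's [perm]. *)
Record Sym (T : Type) := MkSym { Sym_fun :> T -> T; Sym_bij : bijective Sym_fun }.

Section SymGroup.
Variable T : Type.
Implicit Types f g : Sym T.

Lemma Sym_eq f g : f =1 g -> f = g.
Proof.
case: f g => [f bf] [g bg] /= /funext fg.
by case: g / fg bg => bg; congr MkSym; exact: Prop_irrelevance.
Qed.

Lemma Sym_inv_ex f : exists g : T -> T, cancel f g /\ cancel g f.
Proof. by case: (Sym_bij f) => g; exists g. Qed.

Definition Sym_inv_fun f : T -> T := projT1 (cid (Sym_inv_ex f)).

Lemma Sym_invK f : cancel f (Sym_inv_fun f).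
Proof. by rewrite /Sym_inv_fun; case: cid => g []. Qed.

Lemma Sym_Kinv f : cancel (Sym_inv_fun f) f.
Proof. by rewrite /Sym_inv_fun; case: cid => g []. Qed.

Definition Sym_one : Sym T := @MkSym T id (Bijective (fun=> erefl) (fun=> erefl)).
Definition Sym_inv f : Sym T := MkSym (Bijective (Sym_Kinv f) (Sym_invK f)).
Definition Sym_mul f g : Sym T := MkSym (bij_comp (Sym_bij f) (Sym_bij g)).

Lemma Sym_mulA : associative Sym_mul.
Proof. by move=> f g h; exact: Sym_eq. Qed.

Lemma Sym_mul1 : left_id Sym_one Sym_mul.
Proof. by move=> f; exact: Sym_eq. Qed.

Lemma Sym_mulr1 : right_id Sym_one Sym_mul.
Proof. by move=> f; exact: Sym_eq. Qed.

Lemma Sym_mulV : left_inverse Sym_one Sym_inv Sym_mul.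
Proof. by move=> f; apply: Sym_eq => x; exact: Sym_invK. Qed.

Lemma Sym_mulrV : right_inverse Sym_one Sym_inv Sym_mul.
Proof. by move=> f; apply: Sym_eq => x; exact: Sym_Kinv. Qed.

HB.instance Definition _ := gen_eqMixin (Sym T).
HB.instance Definition _ := gen_choiceMixin (Sym T).
HB.instance Definition _ := isGroup.Build (Sym T)
  Sym_mulA Sym_mul1 Sym_mulr1 Sym_mulV Sym_mulrV.

End SymGroup.

Definition ext_order (G : groupType) (x : G) : \bar int :=
  infpos (fun n => (x ^+ n = 1)%g).

HB.mixin Record isShelf (D : Type) := {
  shelf_inhabited : inhabited D;
  shelf_op : D -> D -> D;
  shelf_opD : forall a b c : D,
    shelf_op a (shelf_op b c) = shelf_op (shelf_op a b) (shelf_op a c)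
}.

#[short(type="shelfType")]
HB.structure Definition Shelf := { D of isShelf D }.

Notation "a ▷ b" := (shelf_op a b) (at level 40, left associativity).

HB.mixin Record Shelf_isRack (D : Type) of Shelf D := {
  rack_bij : forall a : D, bijective (fun b : D => a ▷ b)
}.

#[short(type="rackType")]
HB.structure Definition Rack := { D of Shelf D & Shelf_isRack D }.

Section RackTheory.
Variable D : rackType.

Definition is_quandle : Prop := forall a : D, a ▷ a = a.

Definition L (a : D) : Sym D := MkSym (rack_bij a).

Definition derived_sol (p : D * D) : D * D := (p.2, p.2 ▷ p.1).

Lemma derived_sol_bij : bijective derived_sol.
Proof.
exists (fun p => (((L p.1)^-1)%g p.2, p.1)) => [[a b]|[a b]].
  by congr pair; exact: (Sym_invK (L b)).
by congr pair; exact: (Sym_Kinv (L a)).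
Qed.

Definition r_sol : Sym (D * D)%type := MkSym derived_sol_bij.

Definition M_ : \bar int :=
  infpos (fun n => forall a b : D, ((L b * L a) ^+ n * L b ^- n)%g b = a).

Definition N_ : \bar int :=
  infpos (fun n => forall a b : D, ((L b * L a) ^+ n * L b ^- n)%g b = b).

End RackTheory.

Arguments is_quandle D : clear implicits.
Arguments r_sol D : clear implicits.
Arguments M_ D : clear implicits.
Arguments N_ D : clear implicits.

(* Main.v *)
Require Import Defs.
From HB Require Import structures.
From mathcomp Require Import all_boot all_order all_algebra.
From mathcomp Require Import constructive_ereal.
From mathcomp Require Import boolp.
Import Order.TTheory GRing.Theory Num.Theory.
Local Open Scope ring_scope.
Local Open Scope ereal_scope.

(** Iterating the derived solution from (a, b) produces the sequence
    x_0 = a, x_1 = b, x_(k+2) = x_(k+1) ▷ x_k, with r^k (a, b) =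
    (x_k, x_(k+1)).  Since L_(u ▷ v) = L_u L_v L_u^-1, the product
    L_(x_(k+1)) L_(x_k) does not depend on k: it is always h = L_b L_a.  Hence
    x_(k+2) = h (L_(x_k)^-1 x_k), and because L_(L_u^-1 u) = L_u the
    corrections pile up as powers of L_b^-1 only, which gives
    x_(2n+1) = (L_b L_a)^n L_b^-n b (lemma [r_sol_even_snd]).

    This word is at once the second component of r^(2n) (a, b) and the first
    component of r^(2n+1) (a, b).  A power of r that fixes one component of
    every pair is the identity, as it commutes with r, which is surjective and
    shifts components.  So the conditions defining N_D and M_D say exactly that
    r^(2n) = 1 and r^(2n+1) = 1 respectively.

    What remains is arithmetic in the cyclic group generated by r, which is not
    trivial because |D| > 1.  If the order is infinite then so are M_D and
    N_D; if it is 2n then N_D = n and M_D is infinite; if it is 2n+1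
    then M_D = n and N_D = 2n+1 (lemma [order_parityP]).  Finally r^(2n)
    preserves the diagonal, so an odd power of r can be trivial only when
    a ▷ a = a for all a: the last case arises only for quandles. *)

(** * The powers of the derived solution *)

Section SolutionPowers.
Local Open Scope group_scope.
Variable D : rackType.
Implicit Types a b c : D.

Lemma L_equivariant a b : L (L a b) = L a * L b * (L a)^-1.
Proof.
apply: (mulIg (L a)); rewrite mulgVK; apply: Sym_eq => c /=.
by rewrite -shelf_opD.
Qed.

(** The translation does not see the failure of idempotence: b and
    L_b^-1 b, which differ as soon as b ▷ b <> b, act in the same way. *)
Lemma L_inv_self b : L ((L b)^-1 b) = L b.
Proof.
have Kb : L b ((L b)^-1 b) = b by exact: (Sym_Kinv (L b)).
have bE := L_equivariant b ((L b)^-1 b); rewrite Kb in bE.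
by apply: (mulgI (L b)); rewrite [RHS](congr1 ( *%g^~ (L b)) bE) mulgVK.
Qed.

(** The odd-indexed term x_(2n+1) of the sequence x_0 = a, x_1 = b,
    x_(k+2) = x_(k+1) ▷ x_k. *)
Definition orbit_word n a b : D := ((L b * L a) ^+ n * L b ^- n) b.

Lemma r_sol_sqr a b : (r_sol D ^+ 2) (a, b) = (L b a, L (L b a) b).
Proof. by []. Qed.

(** Replacing (a, b) by its image (a', b') under r^2 keeps the product
    h = L_b L_a, while b' = h (L_b^-1 b) and L_b' = h L_b h^-1; so
    h^n L_b'^-n b' = h^n (h L_b^-n h^-1) h L_b^-1 b, which telescopes. *)
Lemma orbit_wordS n a b :
  orbit_word n.+1 a b = orbit_word n (L b a) (L (L b a) b).
Proof.
set h := L b * L a.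
have b'E : L (L b a) b = h ((L b)^-1 b) by rewrite L_equivariant.
have Lb' : L (L (L b a) b) = h * L b * h^-1.
  by rewrite b'E /= !L_equivariant L_inv_self /h invgM !mulgA.
have h'E : L (L (L b a) b) * L (L b a) = h.
  by rewrite Lb' L_equivariant /h invgM !mulgA !mulgVK mulgK.
have Lb'X : L (L (L b a) b) ^- n = h * L b ^- n * h^-1.
  have conjE g : h * g * h^-1 = g ^ h^-1 by rewrite conjgE invgK mulgA.
  by rewrite Lb' !conjE -conjXg -conjVg.
rewrite /orbit_word h'E Lb'X b'E.
rewrite -[RHS]/((h ^+ n * (h * L b ^- n * h^-1) * h * (L b)^-1) b).
congr (Sym_fun _ b); rewrite -/h; move: h {b'E Lb' h'E Lb'X} => h.
by rewrite !mulgA mulgVK -expgSr -mulgA -invgM -expgS.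
Qed.

Lemma r_sol_even_snd n a b : ((r_sol D ^+ n.*2) (a, b)).2 = orbit_word n a b.
Proof.
elim: n a b => [|n IHn] a b; first by rewrite /orbit_word invg1.
by rewrite orbit_wordS -IHn -r_sol_sqr doubleS -addn2 expgnDr.
Qed.

Lemma r_sol_odd_fst n a b :
  ((r_sol D ^+ n.*2.+1) (a, b)).1 = orbit_word n a b.
Proof. by rewrite -r_sol_even_snd expgS. Qed.

Lemma r_sol_comm m p : (r_sol D ^+ m) (r_sol D p) = r_sol D ((r_sol D ^+ m) p).
Proof. by rewrite -[LHS]/((r_sol D ^+ m * r_sol D) p) -expgSr expgS. Qed.

(** The second component of r^m p is the first component of
    r (r^m p) = r^m (r p), hence is controlled by the first component at r p. *)
Lemma r_sol_fst_eq1 m :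
  (forall p, ((r_sol D ^+ m) p).1 = p.1) -> r_sol D ^+ m = 1.
Proof.
move=> fE; apply: Sym_eq => p; rewrite [LHS]surjective_pairing.
rewrite fE -[X in (_, X)]/(r_sol D ((r_sol D ^+ m) p)).1.
by rewrite -r_sol_comm fE -surjective_pairing.
Qed.

(** Every pair p is some r q, and the first component of r^m (r q) is the
    second component of r^m q. *)
Lemma r_sol_snd_eq1 m :
  (forall p, ((r_sol D ^+ m) p).2 = p.2) -> r_sol D ^+ m = 1.
Proof.
move=> sE; apply: r_sol_fst_eq1 => p.
have [q <-] : exists q, r_sol D q = p.
  by exists ((r_sol D)^-1 p); exact: Sym_Kinv.
by rewrite r_sol_comm; exact: sE.
Qed.

Lemma r_sol_even_eq1 n :
  (forall a b, orbit_word n a b = b) <-> r_sol D ^+ n.*2 = 1.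
Proof.
split=> [wE|r1 a b]; last by rewrite -r_sol_even_snd r1.
by apply: r_sol_snd_eq1 => -[a b]; rewrite r_sol_even_snd wE.
Qed.

Lemma r_sol_odd_eq1 n :
  (forall a b, orbit_word n a b = a) <-> r_sol D ^+ n.*2.+1 = 1.
Proof.
split=> [wE|r1 a b]; last by rewrite -r_sol_odd_fst r1.
by apply: r_sol_fst_eq1 => -[a b]; rewrite r_sol_odd_fst wE.
Qed.

(** Already r^2 maps (a, a) to (a ▷ a, a ▷ a), because L_(a ▷ a) = L_a. *)
Lemma r_sol_even_diag n a : exists c, (r_sol D ^+ n.*2) (a, a) = (c, c).
Proof.
elim: n a => [|n IHn] a; first by exists a.
have [c cE] := IHn (a ▷ a); exists c; rewrite -cE doubleS -addn2 expgnDr.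
rewrite -[LHS]/((r_sol D ^+ n.*2) (L a a, L (L a a) a)).
by rewrite L_equivariant mulgK.
Qed.

(** The image of (a, a) under r^(2n) is some (c, c), and
    r (c, c) = (c, c ▷ c) can be (a, a) only if c = a and a ▷ a = a. *)
Lemma r_sol_odd_quandle n : r_sol D ^+ n.*2.+1 = 1 -> is_quandle D.
Proof.
move=> r1 a; have [c cE] := r_sol_even_diag n a.
have : (r_sol D ^+ n.*2.+1) (a, a) = (a, a) by rewrite r1.
by rewrite expgS -[LHS]/(r_sol D ((r_sol D ^+ n.*2) (a, a))) cE => -[->].
Qed.

Lemma r_sol_neq1 : (exists a b : D, a <> b) -> r_sol D <> 1.
Proof.
move=> [a [b abN]] r1; apply: abN.
by have := congr1 (fun f : Sym (D * D) => (f (a, b)).1) r1.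
Qed.

Lemma N_E : N_ D = infpos (fun n => r_sol D ^+ n.*2 = 1).
Proof.
by congr infpos; apply/funext => n; apply/propext; exact: r_sol_even_eq1.
Qed.

Lemma M_E : M_ D = infpos (fun n => r_sol D ^+ n.*2.+1 = 1).
Proof.
by congr infpos; apply/funext => n; apply/propext; exact: r_sol_odd_eq1.
Qed.

End SolutionPowers.

(** * Even and odd exponents that kill a group element *)

Section OrderParity.
Local Open Scope group_scope.
Variables (G : groupType) (x : G).

Lemma torsion_order n : (0 < n)%N -> x ^+ n = 1 ->
  exists d, (0 < d)%N /\ forall m, x ^+ m = 1 <-> (d %| m)%N.
Proof.
move=> n0 xn; have Pex : exists m, (0 < m)%N && (x ^+ m == 1).
  by exists n; rewrite n0 xn eqxx.
case: (ex_minnP Pex) => d /andP[d0 /eqP xd] dmin.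
exists d; split=> // m; split=> [xm|/dvdnP[k ->]]; last first.
  by rewrite mulnC expgnA xd expg1n.
have xr : x ^+ (m %% d) = 1.
  by move: xm; rewrite {1}(divn_eq m d) expgnDr mulnC expgnA xd expg1n mul1g.
rewrite /dvdn eqn0Ngt; apply/negP => r0.
by have := dmin (m %% d)%N; rewrite r0 xr eqxx leqNgt ltn_mod d0 => /(_ isT).
Qed.

(** The possible values of the order of x, of the least n > 0 with
    x^(2n+1) = 1, and of the least n > 0 with x^(2n) = 1. *)
Variant order_parity : \bar int -> \bar int -> \bar int -> Prop :=
| OrderInfinite : order_parity +oo%E +oo%E +oo%E
| OrderEven n : (0 < n)%N ->
    order_parity n.*2%:Z%:E%R +oo%E n%:Z%:E%R
| OrderOdd n : (0 < n)%N -> x ^+ n.*2.+1 = 1 ->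
    order_parity n.*2.+1%:Z%:E%R n%:Z%:E%R n.*2.+1%:Z%:E%R.

(** The exponents that kill x are the multiples of its order d.  For
    d = 2k+1 the first even one is 2d; for d = 2k there is no odd one.
    Since x <> 1 excludes d = 1, the odd case has k > 0, and d = 2k+1
    itself is among the exponents 2n+1 with n > 0. *)
Lemma order_parityP : x <> 1 ->
  order_parity (ext_order x) (infpos (fun n => x ^+ n.*2.+1 = 1))
    (infpos (fun n => x ^+ n.*2 = 1)).
Proof.
move=> x1; have [[n [n0 xn]]|xoo] := pselect (exists n, (0 < n)%N /\ x ^+ n = 1).
  have [d [d0 xE]] := torsion_order n n0 xn.
  have ordE : ext_order x = d%:Z%:E%R.
    by apply: infpos_min => // [|m m0 /xE]; [exact/xE|exact: dvdn_leq].
  have [k [] dE] : exists k, d = k.*2.+1 \/ d = k.*2.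
  - by exists d./2; rewrite -{1 3}[d]odd_double_half; case: odd; [left|right].
  - have k0 : (0 < k)%N.
      rewrite lt0n; apply/eqP => k0; apply: x1.
      by rewrite -[x]expg1; apply/xE; rewrite dE k0.
    have -> : infpos (fun n => x ^+ n.*2.+1 = 1) = k%:Z%:E%R.
      apply: infpos_min => // [|m _ /xE]; first by apply/xE; rewrite dE.
      by move=> /(dvdn_leq (ltn0Sn _)); rewrite dE ltnS leq_double.
    have -> : infpos (fun n => x ^+ n.*2 = 1) = d%:Z%:E%R.
      apply: infpos_min => // [|m m0 /xE].
        by apply/xE; rewrite -muln2 dvdn_mulr.
      rewrite -muln2 Gauss_dvdl; first exact: dvdn_leq.
      by rewrite coprimen2 dE /= odd_double.
    by rewrite ordE dE; apply: OrderOdd => //; apply/xE; rewrite dE.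
  - have k0 : (0 < k)%N by rewrite -double_gt0 -dE.
    rewrite infpos_oo; last first.
      move=> m m0 /xE; rewrite dE -muln2 => /(dvdn_trans (dvdn_mull _ (dvdnn 2))).
      by rewrite dvdn2 /= odd_double.
    have -> : infpos (fun n => x ^+ n.*2 = 1) = k%:Z%:E%R.
      apply: infpos_min => // [|m m0 /xE]; first by apply/xE; rewrite dE.
      by rewrite dE -!muln2 dvdn_pmul2r //; exact: dvdn_leq.
    by rewrite ordE dE; exact: OrderEven.
rewrite /ext_order !infpos_oo; first exact: OrderInfinite.
- by move=> m m0 xm; apply: xoo; exists m.*2; rewrite double_gt0.
- by move=> m m0 xm; apply: xoo; exists m.*2.+1.
- by move=> m m0 xm; apply: xoo; exists m.
Qed.

End OrderParity.

(** * The order of the derived solution *)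

Theorem theorem1p19 (D : rackType) (hD : exists a b : D, a <> b) :
  (~ is_quandle D ->
     (ext_order (r_sol D) \is a fin_num <-> N_ D \is a fin_num) /\
     ext_order (r_sol D) = 2%:E * N_ D) /\
  (is_quandle D ->
     [/\ ext_order (r_sol D) \is a fin_num <->
           Order.min (M_ D) (N_ D) \is a fin_num,
         ext_order (r_sol D) \is a fin_num -> M_ D < N_ D \/ N_ D < M_ D,
         M_ D < N_ D -> ext_order (r_sol D) = 2%:E * M_ D + 1%:E
       & N_ D < M_ D -> ext_order (r_sol D) = 2%:E * N_ D]).
Proof.
rewrite M_E N_E.
have dblE n : n.*2%:Z%:E = 2%:E * n%:Z%:E by rewrite -EFinM -PoszM mul2n.
have mul2oo : 2%:E * +oo = +oo :> \bar int by rewrite gt0_muley.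
case: (order_parityP _ (r_sol D) (r_sol_neq1 D hD)) => [|n n0|n n0 r1].
- by split=> [_|_]; split; rewrite ?mul2oo ?minxx ?ltxx.
- split=> [_|_]; first by split; [|exact: dblE].
  by split=> // _; right; rewrite ltry.
split=> [nq|_]; first by case: nq; exact: r_sol_odd_quandle r1.
have MN : n%:Z%:E < n.*2.+1%:Z%:E by rewrite lte_fin ltz_nat ltnS -addnn leq_addr.
split=> //.
- by rewrite min_l // ltW.
- by left.
- by rewrite -dblE -EFinD -PoszD addn1.
- by rewrite ltNge (ltW MN).
Qed.
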